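(* For all integers $n\geq 2$, the degenerate Bernoulli numbers satisfy $$\sum_{k=1}^n\binom{n}{k}_{c;q}\mathcal{B}_{k;q}\,\mathcal{B}_{n-k;q}=-n\,\mathcal{B}_{n;q}-n\,\mathcal{B}_{n-1;q}\,\frac{(n-1)-q(n-2)}{(n-1)q-(n-2)}.$$
   Context: Fix a complex parameter $q\neq 1$ such that $jq-(j-1)\neq 0$ for all integers $j\ge 1$. Let $Q_0(q)=1$, $Q_n(q)=\prod_{j=1}^{n}(jq-(j-1))$, and $c_{0;q}=1$, $c_{n;q}=n!/Q_{n-1}(q)$ for $n\ge 1$. The Carlitz-Tsallis deformed exponential is $e_q(x)=(1+(1-q)x)^{1/(1-q)}=\sum_{n\ge 0}x^n/c_{n;q}$ (as a formal power series). Put $\binom{n}{k}_{c;q}=\frac{c_{n;q}}{c_{k;q}c_{n-k;q}}$ for $0\le k\le n$. The degenerate Bernoulli numbers $\mathcal{B}_{n;q}$ are defined by the formal power series identity in $t$: $\frac{t}{e_q(t)-1}=\sum_{n\ge0}\mathcal{B}_{n;q}\frac{t^n}{c_{n;q}}$. *)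

(* Defs.v *)
From HB Require Import structures.
From mathcomp Require Import all_boot all_order all_algebra.
From mathcomp Require Import reals.
From mathcomp Require Export complex.
From mathcomp Require Import ring.

Set Implicit Arguments.
Unset Strict Implicit.
Unset Printing Implicit Defensive.

Import Order.TTheory GRing.Theory Num.Theory.
Local Open Scope ring_scope.

(* A formal power series is the sequence of its coefficients, and equality of
   series is [=1]. Addition and subtraction are coefficientwise. *)
Definition fps (K : Type) : Type := nat -> K.

Section FormalPowerSeries.
Variable K : nzRingType.

Definition fps_one : fps K := fun n => (n == 0%N)%:R.
Definition fps_X : fps K := fun n => (n == 1%N)%:R.
Definition fps_sub (f g : fps K) : fps K := fun n => f n - g n.
Definition fps_mul (f g : fps K) : fps K :=
  fun n => \sum_(0 <= i < n.+1) f i * g (n - i)%N.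

End FormalPowerSeries.

Arguments fps_one {K}.
Arguments fps_X {K}.

Section DegenerateBernoulli.
Variable K : fieldType.
Implicit Types (q : K) (B : nat -> K).

Definition Qprod q (n : nat) : K :=
  \prod_(1 <= j < n.+1) (j%:R * q - (j%:R - 1)).

Definition ccoef q (n : nat) : K :=
  if n is m.+1 then (m.+1)`!%:R / Qprod q m else 1.

Definition cbinom q (n k : nat) : K :=
  ccoef q n / (ccoef q k * ccoef q (n - k)%N).

Definition eq_exp q : fps K := fun n => 1 / ccoef q n.

(* F = t / (e_q(t) - 1) is read in the integral domain K[[t]] as
   F * (e_q(t) - 1) = t; the series e_q(t) - 1 is not invertible there, but it
   is nonzero, and by [degenerate_bernoulli_exists] and
   [degenerate_bernoulli_unique] below there is exactly one such F. *)
Definition degenerate_bernoulli q B : Prop :=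
  fps_mul (fun n => B n / ccoef q n) (fps_sub (eq_exp q) fps_one) =1 fps_X.

End DegenerateBernoulli.

Section SanityChecks.
Variables (K : numFieldType) (q : K).
Hypothesis hq : q != 1.
Hypothesis hQ : forall j : nat, (1 <= j)%N -> j%:R * q - (j%:R - 1) != 0.

Lemma Qprod_neq0 n : Qprod q n != 0.
Proof.
rewrite /Qprod big_add1 /= big_mkord; apply/prodf_neq0 => i _; exact: hQ.
Qed.

Lemma ccoef_neq0 n : ccoef q n != 0.
Proof.
case: n => [|n] /=; first exact: oner_neq0.
by rewrite mulf_neq0 ?invr_eq0 ?Qprod_neq0 // pnatr_eq0 -lt0n fact_gt0.
Qed.

(* Newton's binomial series of (1 + a x)^s. *)
Definition binomial_series (a s : K) : fps K :=
  fun n => (\prod_(i < n) (s - i%:R)) / n`!%:R * a ^+ n.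

Lemma eq_exp_closed_form :
  eq_exp q =1 binomial_series (1 - q) (1 - q)^-1.
Proof.
have h1 : 1 - q != 0 by rewrite subr_eq0 eq_sym.
move=> [|n]; rewrite /eq_exp /binomial_series /=.
  by rewrite big_ord0 fact0 expr0 !divr1 mulr1.
rewrite div1r invf_div mulrAC; congr (_ / _).
rewrite /Qprod -[in _ ^+ _](card_ord n.+1) -prodr_const -big_split /=.
rewrite big_ord_recl /= subr0 mulVf // mul1r big_add1 /= big_mkord.
by apply: eq_bigr => i _; rewrite mulrBl mulVf //= /bump /= add1n; ring.
Qed.

Lemma fps_mul_eq_exp_sub1 (f : fps K) n :
  fps_mul f (fps_sub (eq_exp q) fps_one) n.+1 =
  \sum_(0 <= i < n) f i * eq_exp q (n.+1 - i)%N + f n.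
Proof.
have e0 : fps_sub (eq_exp q) fps_one 0%N = 0.
  by rewrite /fps_sub /eq_exp /fps_one /= divr1 subrr.
have e1 : fps_sub (eq_exp q) fps_one 1%N = 1.
  by rewrite /fps_sub /eq_exp /fps_one /= /Qprod big_geq // subr0 !divr1.
rewrite /fps_mul 2?big_nat_recr //= subnn e0 mulr0 addr0 subSnn e1 mulr1.
congr (_ + _); apply: eq_big_nat => i /andP[_ lt_in].
by rewrite /fps_sub /fps_one subSn ?(ltnW lt_in) //= subr0.
Qed.

Lemma degenerate_bernoulli_unique (B B' : nat -> K) :
  degenerate_bernoulli q B -> degenerate_bernoulli q B' -> B =1 B'.
Proof.
move=> hB hB' n; elim/ltn_ind: n => n IH.
have := etrans (hB n.+1) (esym (hB' n.+1)); rewrite !fps_mul_eq_exp_sub1.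
rewrite (eq_big_nat _ _ (F2 := fun i => B' i / ccoef q i * eq_exp q (n.+1 - i)%N)).
  by move/addrI/(mulIf (invr_neq0 (ccoef_neq0 n))).
by move=> i /andP[_ /IH ->].
Qed.

Lemma degenerate_bernoulli_exists :
  exists B : nat -> K, degenerate_bernoulli q B.
Proof.
pose step (s : seq K) := rcons s ((size s == 0%N)%:R -
  \sum_(0 <= i < size s) s`_i * eq_exp q ((size s).+1 - i)%N).
pose S n := iter n step [::].
have sizeS n : size (S n) = n by elim: n => //= n IH; rewrite size_rcons IH.
pose f n := (S n.+1)`_n.
have nthS n i : (i < n)%N -> (S n)`_i = f i.
  elim: n => // n IH; rewrite ltnS leq_eqVlt => /predU1P[->//|lt_in].
  by rewrite /= nth_rcons sizeS lt_in IH.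
exists (fun n => f n * ccoef q n) => n.
rewrite (_ : fps_mul _ _ n = fps_mul f (fps_sub (eq_exp q) fps_one) n); last first.
  by apply: eq_bigr => i _; rewrite mulfK ?ccoef_neq0.
case: n => [|n].
  by rewrite /fps_mul big_nat1 /fps_sub /eq_exp /fps_one /= divr1 subrr mulr0.
rewrite fps_mul_eq_exp_sub1 [X in _ + X = _]/f /= nth_rcons sizeS ltnn eqxx.
rewrite [X in _ - X](eq_big_nat _ _ (F2 := fun i => f i * eq_exp q (n.+1 - i)%N)).
  by rewrite addrCA subrr addr0.
by move=> i /andP[_ lt_in]; rewrite nthS.
Qed.

End SanityChecks.

(* Main.v *)
Require Import Defs.
From mathcomp Require Import all_boot all_order all_algebra.
From mathcomp Require Import reals complex.
From mathcomp Require Import ring.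

(** Write E for e_q(t) and F for t / (E - 1), so that F has coefficients
    B n / c_n. The deformed exponential solves the linear equation
    (1 + (1 - q) t) E' = E ([eq_exp_ode]). Differentiating F (E - 1) = t gives
    F' (E - 1) + F E' = 1; multiplying by F (1 + (1 - q) t) and replacing
    F (E - 1) by t and F E by F + t eliminates E altogether, and leaves the
    Riccati equation
      F^2 = F - q t F - t F' - (1 - q) t^2 F'    ([bernoulli_riccati]).
    The coefficient of t^n, multiplied by c_n, is the convolution identity:
    the term k = 0 of the convolution is B n because F has constant term 1,
    and the fraction comes from the ratio c_n / c_(n-1) ([ccoefS]).

    The Riccati equation is derived on truncations, so that derivatives and
    the ring structure are those of polynomials: a coefficientwise identity
    below degree N becomes an equality up to a multiple of 'X^N, and such a
    remainder only drops to a multiple of 'X^N.-1 under differentiation. *)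

Set Implicit Arguments.
Unset Strict Implicit.
Unset Printing Implicit Defensive.

Import Order.TTheory GRing.Theory Num.Theory.
Local Open Scope ring_scope.

Definition fps_trunc (K : nzRingType) (N : nat) (f : fps K) : {poly K} :=
  \poly_(i < N) f i.

Lemma coef_fps_trunc (K : nzRingType) N (f : fps K) i :
  (i < N)%N -> (fps_trunc N f)`_i = f i.
Proof. by move=> lt_iN; rewrite coef_poly lt_iN. Qed.

Lemma coef_fps_trunc_mul (K : nzRingType) N (f g : fps K) i :
  (i < N)%N -> (fps_trunc N f * fps_trunc N g)`_i = fps_mul f g i.
Proof.
move=> lt_iN; rewrite coefM /fps_mul big_mkord; apply: eq_bigr => j _.
rewrite !coef_fps_trunc ?(leq_ltn_trans (leq_subr _ _)) //.
by rewrite (leq_ltn_trans _ lt_iN) // -ltnS.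
Qed.

(** Turns agreement of coefficients below N into a ring equation with an
    explicit remainder, which can be differentiated and multiplied. *)
Lemma poly_eq_mod_Xn (K : nzRingType) N (p r : {poly K}) :
  (forall i, (i < N)%N -> p`_i = r`_i) -> exists s, p = r + s * 'X^N.
Proof.
move=> eq_pr; exists (drop_poly N (p - r)).
have take0 : take_poly N (p - r) = 0.
  apply/polyP => i; rewrite coef_take_poly coef0 coefB.
  by case: ifP => // /eq_pr ->; rewrite subrr.
by have := poly_take_drop N (p - r); rewrite take0 add0r => ->; rewrite addrC subrK.
Qed.

Section DegenerateBernoulliConvolution.
Variables (K : numFieldType) (q : K).

Lemma ccoefS n :
  ccoef q n.+2 = ccoef q n.+1 * (n.+2%:R / (n.+1%:R * q - (n.+1%:R - 1))).
Proof.
by rewrite /ccoef /Qprod mulf_div [in LHS]big_nat_recr // factS natrM [_%:R * _]mulrC.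
Qed.

(** The coefficient form of (1 + (1 - q) t) E' = E. Since n.+1 / c_(n.+1) is
    Q_n / n!, for n > 0 it amounts to
    Q_n / Q_(n-1) = n q - (n - 1) = 1 - n (1 - q). *)
Lemma eq_exp_ode n :
  eq_exp q n.+1 *+ n.+1 + (1 - q) * (eq_exp q n *+ n) = eq_exp q n.
Proof.
case: n => [|n].
  by rewrite /eq_exp /= /Qprod big_geq // mulr0n mulr0 addr0 !divr1.
rewrite /eq_exp ccoefS !div1r invfM (invf_div n.+2%:R); move: (ccoef q n.+1)^-1 => x.
have n2 : n.+2%:R != 0 :> K by rewrite pnatr_eq0.
by field; move: n2; rewrite -addn2 natrD addrC.
Qed.

(** The series E can be eliminated because its logarithmic derivative is
    rational: F' is then a quadratic polynomial in F over the rational functions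
    of t, namely F^2 = F - q t F - t F' - (1 - q) t^2 F'. *)
Lemma bernoulli_riccati (F : fps K) n :
    fps_mul F (fps_sub (eq_exp q) fps_one) =1 fps_X ->
  fps_mul F F n.+1 =
    F n.+1 - q * F n - F n.+1 *+ n.+1 - (1 - q) * (F n *+ n).
Proof.
(* The coefficient of degree n.+1 is read off modulo 'X^N.-1, since one factor
   'X is lost by differentiating a multiple of 'X^N. *)
move=> hF; pose N := n.+3.
pose f := fps_trunc N F; pose e := fps_trunc N (fps_sub (eq_exp q) fps_one).
pose w : {poly K} := 1 + (1 - q)%:P * 'X.
have [r fe] : exists r : {poly K}, f * e = 'X + r * 'X^N.
  by apply: poly_eq_mod_Xn => i lt_iN; rewrite coef_fps_trunc_mul // hF coefX.
have [s ode] : exists s : {poly K}, w * e^`() = e + 1 + s * 'X^(n.+2).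
  apply: poly_eq_mod_Xn => i lt_in.
  rewrite mulrDl mul1r -mulrA coefD coefCM coefXM coefD coef1 !coef_deriv /e.
  rewrite !coef_fps_trunc ?ltnS ?(leq_trans (leq_pred _)) ?(ltnW lt_in) //.
  rewrite [in RHS]/fps_sub /fps_one subrK -(eq_exp_ode i).
  case: i lt_in => [|i] lt_in /=; first by rewrite /fps_sub subr0 mulr0n.
  by rewrite /fps_sub !subr0.
have XN : 'X^N = 'X * 'X^(n.+2) :> {poly K} by rewrite -exprS.
have dfe : f^`() * e + f * e^`() = 1 + (r^`() * 'X + r *+ N) * 'X^(n.+2).
  by rewrite -derivM fe derivD derivX derivM derivXn XN; ring.
have [g riccati] : exists g : {poly K}, f * f =
    f - q *: ('X * f) - 'X * f^`() - (1 - q) *: ('X * ('X * f^`())) + g * 'X^(n.+2).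
  exists (f * w * (r^`() * 'X + r *+ N)
          - w * f^`() * r * 'X - f * r * 'X - f * f * s).
  (* The derivative of f * e = t times f * w, regrouped so that e and its
     derivative occur only in f * e and in w * e^`(). *)
  have key : w * f^`() * (f * e) + f * (f * (w * e^`())) =
      f * w * (f^`() * e + f * e^`()) by ring.
  move: key; rewrite dfe ode.
  rewrite (_ : f * (f * (e + 1 + s * 'X^(n.+2))) =
      f * (f * e) + f * f + f * f * s * 'X^(n.+2)); last by ring.
  rewrite fe => key.
  (* Isolate f * f by subtracting the other terms of the left side of key. *)
  rewrite [LHS](_ : _ =
       (w * f^`() * ('X + r * 'X^N)
        + (f * ('X + r * 'X^N) + f * f + f * f * s * 'X^(n.+2)))
       - w * f^`() * ('X + r * 'X^N)
       - f * ('X + r * 'X^N) - f * f * s * 'X^(n.+2)); last by ring.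
  by rewrite key /w -!mul_polyC polyCB polyC1 XN; ring.
have := congr1 (fun p : {poly K} => p`_n.+1) riccati.
rewrite coef_fps_trunc_mul // => ->.
rewrite !coefD !coefN !coefZ coefMXn ltnSn addr0 !coefXM /= !coef_deriv.
have -> : (if n == 0%N then 0 else f`_n.-1.+1 *+ n.-1.+1) = f`_n *+ n.
  by case: (n) => [|m]; rewrite ?mulr0n.
by rewrite /f !coef_fps_trunc // ltnW.
Qed.

End DegenerateBernoulliConvolution.

Theorem theorem3p7 (R : realType) (q : R[i])
  (hq : q != 1)
  (hQ : forall j : nat, (1 <= j)%N -> j%:R * q - (j%:R - 1) != 0)
  (B : nat -> R[i]) (hB : degenerate_bernoulli q B)
  (n : nat) (hn : (2 <= n)%N) :
  \sum_(1 <= k < n.+1) cbinom q n k * B k * B (n - k)%N =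
    - (n%:R * B n)
    - n%:R * B (n - 1)%N *
      (((n%:R - 1) - q * (n%:R - 2)) / ((n%:R - 1) * q - (n%:R - 2))).
Proof.
case: n hn => [|[|n]] // _.
pose F k := B k / ccoef q k.
have BE k : B k = F k * ccoef q k by rewrite divfK ?ccoef_neq0.
have F0 : F 0%N = 1.
  by have := hB 1%N; rewrite fps_mul_eq_exp_sub1 // big_geq // add0r.
have -> : \sum_(1 <= k < n.+3) cbinom q n.+2 k * B k * B (n.+2 - k)%N =
    ccoef q n.+2 * (fps_mul F F n.+2 - F n.+2).
  (* The term k = 0 of the square is F n.+2, as F has constant term 1. *)
  rewrite /fps_mul [in RHS]big_ltn // F0 mul1r subn0 addrC addKr mulr_sumr.
  by apply: eq_bigr => k _; rewrite /cbinom invfM /F; ring.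
rewrite (bernoulli_riccati (F := F) n.+1 hB) subSS subn0 !BE.
have d0 := hQ n.+1 isT.
rewrite ccoefS; move: (ccoef q n.+1) => c.
have n2 : n.+2%:R = n.+1%:R + 1 :> R[i] by rewrite natr1.
have -> : (n.+2%:R - 1) * q - (n.+2%:R - 2) = n.+1%:R * q - (n.+1%:R - 1) :> R[i].
  by rewrite n2; ring.
by move: (F n.+1) (F n.+2) => x y; field; rewrite nat1r.
Qed.
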